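(* Let $H_0>0$, $b_1,b_2$ be constants, let $\tilde t^0\in\mathbb{R}$, and let $f=f(t)$ satisfy $$\frac{df}{dt}+b_2\,(g+b_2f^2)\int_{\tilde t^0}^{t}f(t_1)\,dt_1=0,\qquad f(t_0)=f^0.$$ Define $$H(x,t)=\max\left(H_0-\frac{b_2}{2}\left(x-\int_{\tilde t^0}^{t}f(t_1)\,dt_1\right)^2,\,0\right),\qquad z_b(x)=b_1+\frac{b_2}{2}x^2,\qquad \eta=H+z_b,$$ $$\overline{u}(x,t)=f(t)\,\mathbf{1}_{H>0},\qquad \overline{w}(x,t)=b_2\,x\,f(t)\,\mathbf{1}_{H>0},\qquad s(x,t)=b_2\,x\,\frac{df}{dt},$$ and define $\overline{p}$ (and thereby $\overline{p}_{nh}$) by $$\overline{p}=\frac{g}{2}H+\overline{p}_{nh}=\frac1H\int_{z_b}^{\eta}p(x,z,t)\,dz,\qquad p(x,z,t)=(g+b_2f^2)(H+z_b-z)\,\mathbf{1}_{H>0}.$$ Then $H,\overline{u},\overline{w},z_b,\overline{p}$ are analytical solutions of the depth-averaged Euler system completed with the source term $s$, namely $$\frac{\partial H}{\partial t}+\frac{\partial}{\partial x}(H\overline{u})=0,$$ $$\frac{\partial}{\partial t}(H\overline{u})+\frac{\partial}{\partial x}\left(H\overline{u}^2+\frac g2H^2+H\overline{p}_{nh}\right)=-(gH+2\overline{p}_{nh})\frac{\partial z_b}{\partial x},$$ $$\frac{\partial}{\partial t}(H\overline{w})+\frac{\partial}{\partial x}(H\overline{w}\,\overline{u})=2\overline{p}_{nh}+Hs,$$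 $$\frac{\partial}{\partial t}\left(\frac{\eta^2-z_b^2}{2}\right)+\frac{\partial}{\partial x}\left(\frac{\eta^2-z_b^2}{2}\,\overline{u}\right)=H\overline{w}.$$
   Context: $x\in\mathbb{R}$ is the horizontal coordinate, $z$ the vertical one, $t$ time, $g$ the constant gravity acceleration. $z_b$ is the bottom elevation, $H$ the water height, $\eta=H+z_b$ the free surface, $\overline{u},\overline{w}$ the depth-averaged horizontal and vertical velocities, $\overline{p}$ the depth-averaged pressure and $\overline{p}_{nh}$ its non-hydrostatic part. $\mathbf{1}_{H>0}$ equals $1$ where $H(x,t)>0$ and $0$ elsewhere, so that dry zones ($H=0$) and moving wet/dry fronts are included. The forcing $s$ is an external acceleration added to the right-hand side of the vertical momentum equation of the Euler system; it does not depend on $z$, so its integral over the water depth is $Hs$. *)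

(* Defs.v *)
(* Stdlib reals with Coquelicot. *)
From Stdlib Require Import Reals.
From Coquelicot Require Import Coquelicot.
Open Scope R_scope.

(** Space-time functions take the horizontal coordinate first: [U x t]. *)

Definition in_open (a b : Rbar) (t : R) : Prop := Rbar_lt a t /\ Rbar_lt t b.

(** ** Solutions of a balance law  dU/dt + dF/dx = S  on  R x (a,b) *)

Definition dx (phi : R -> R -> R) (x t : R) : R := Derive (fun y => phi y t) x.
Definition dt (phi : R -> R -> R) (x t : R) : R := Derive (fun s => phi x s) t.

Definition classical_at (U F S : R -> R -> R) (x t : R) : Prop :=
  ex_derive (fun s => U x s) t /\ ex_derive (fun y => F y t) x /\
  dt U x t + dx F x t = S x t.

(** [phi] is C^1 with compact support in R x (a,b); [A,B] x [C,D] is a box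
    containing the support.  Every C^infinity test function qualifies, so that
    testing with C^1 functions is at least as strong as the equation in the
    sense of distributions. *)
Definition test_function (a b : Rbar) (A B C D : R) (phi : R -> R -> R) : Prop :=
  (A < B /\ C < D /\ in_open a b C /\ in_open a b D) /\
  (forall x t, ex_derive (fun y => phi y t) x /\ ex_derive (fun s => phi x s) t) /\
  (forall x t, continuity_2d_pt (dx phi) x t /\ continuity_2d_pt (dt phi) x t) /\
  (forall x t, ~ (A <= x <= B /\ C <= t <= D) -> phi x t = 0).

(** The iterated Riemann integral of [K] over [A,B] x [C,D] exists and is [I]. *)
Definition is_RInt_box (K : R -> R -> R) (A B C D I : R) : Prop :=
  exists G : R -> R,
    (forall t, C <= t <= D -> is_RInt (fun x => K x t) A B (G t)) /\
    is_RInt G C D I.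

Definition weak_solution (a b : Rbar) (U F S : R -> R -> R) : Prop :=
  forall (A B C D : R) (phi : R -> R -> R),
    test_function a b A B C D phi ->
    exists I1 I2 I3 : R,
      is_RInt_box (fun x t => U x t * dt phi x t) A B C D I1 /\
      is_RInt_box (fun x t => F x t * dx phi x t) A B C D I2 /\
      is_RInt_box (fun x t => S x t * phi x t) A B C D I3 /\
      I1 + I2 + I3 = 0.

(** The points that do not lie on a wet/dry front: the water height is positive
    around the point, or vanishes around it. *)
Definition off_front (H : R -> R -> R) (x t : R) : Prop :=
  locally_2d (fun y s => 0 < H y s) x t \/ locally_2d (fun y s => H y s = 0) x t.

(** The water height of a solution with wet/dry fronts is only Lipschitz, so the
    equation cannot be pointwise at the fronts: it is required pointwise at all
    other points, wet or dry, and in the weak sense on the whole of R x (a,b),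
    fronts included. *)
Definition solves (a b : Rbar) (H U F S : R -> R -> R) : Prop :=
  (forall x t, in_open a b t -> off_front H x t -> classical_at U F S x t) /\
  weak_solution a b U F S.

(** ** The depth-averaged Euler system, for depth averages [u], [w], [pbar], with
    source [s] in the vertical momentum *)

Definition depth_averaged_euler (g : R) (a b : Rbar)
    (H u w : R -> R -> R) (zb : R -> R) (pbar s : R -> R -> R) : Prop :=
  let eta x t := H x t + zb x in
  let pnh x t := pbar x t - g / 2 * H x t in
  (forall x, ex_derive zb x) /\
  solves a b H
    H
    (fun x t => H x t * u x t)
    (fun _ _ => 0) /\
  solves a b H
    (fun x t => H x t * u x t)
    (fun x t => H x t * u x t ^ 2 + g / 2 * H x t ^ 2 + H x t * pnh x t)
    (fun x t => - (g * H x t + 2 * pnh x t) * Derive zb x) /\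
  solves a b H
    (fun x t => H x t * w x t)
    (fun x t => H x t * w x t * u x t)
    (fun x t => 2 * pnh x t + H x t * s x t) /\
  solves a b H
    (fun x t => (eta x t ^ 2 - zb x ^ 2) / 2)
    (fun x t => (eta x t ^ 2 - zb x ^ 2) / 2 * u x t)
    (fun x t => H x t * w x t).

(** ** The explicit solution; [ti] is the origin of the time integral *)

Definition sol_H (H0 b2 ti : R) (f : R -> R) (x t : R) : R :=
  Rmax (H0 - b2 / 2 * (x - RInt f ti t) ^ 2) 0.

Definition sol_zb (b1 b2 x : R) : R := b1 + b2 / 2 * x ^ 2.

Definition wet (H : R -> R -> R) (x t : R) : R :=
  if Rlt_dec 0 (H x t) then 1 else 0.

Definition sol_u (H : R -> R -> R) (f : R -> R) (x t : R) : R :=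
  f t * wet H x t.

Definition sol_w (H : R -> R -> R) (b2 : R) (f : R -> R) (x t : R) : R :=
  b2 * x * f t * wet H x t.

Definition sol_s (b2 : R) (f : R -> R) (x t : R) : R := b2 * x * Derive f t.

Definition sol_p (g b2 : R) (H : R -> R -> R) (zb : R -> R) (f : R -> R)
    (x z t : R) : R :=
  (g + b2 * f t ^ 2) * (H x t + zb x - z) * wet H x t.

(** Where [H] vanishes the integral is 0, hence so is the average, whatever the
    value of [/ 0]. *)
Definition depth_average (H : R -> R -> R) (zb : R -> R) (p : R -> R -> R -> R)
    (x t : R) : R :=
  / H x t * RInt (fun z => p x z t) (zb x) (H x t + zb x).

(* Main.v *)
Require Import Defs.
From Stdlib Require Import Reals Lra.
From Coquelicot Require Import Coquelicot.
Open Scope R_scope.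

(** With [X t] the integral of [f] from [ti] to [t], every conserved quantity has
    the form [U x t = q (x - X t) t]: the parabolic cap is carried rigidly at speed
    [X' = f], and the fluxes are [U * f] plus, for the horizontal momentum only,
    the pressure [E = (g + b2 f^2) / 2 * H^2], which is C^1 across the fronts.
    In the frame [xi = x - X t] the kink of [H] does not depend on time, so [q] is
    C^1 in time although only continuous in [xi].  Against a test function [phi],
      [int (U phi_t + U f phi_x + q_t phi) dx
         = d/dt int q(xi,t) phi(xi + X t, t) dxi]
    by differentiation under the integral sign, and the time integral vanishes
    because [phi] does at both ends.  The term [E] is integrated by parts in [x]. *)

(** * Continuity in two variables and integrals depending on a parameter *)

Lemma continuity_2d_pt_comp (f g h : R -> R -> R) (x y : R) :
  continuity_2d_pt f (g x y) (h x y) ->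
  continuity_2d_pt g x y -> continuity_2d_pt h x y ->
  continuity_2d_pt (fun u v => f (g u v) (h u v)) x y.
Proof.
  intros Hf Hg Hh; apply continuity_2d_pt_filterlim.
  apply (continuous_comp_2 (fun z : R * R => g (fst z) (snd z))
           (fun z : R * R => h (fst z) (snd z)) f (x, y));
    now apply continuity_2d_pt_filterlim.
Qed.

Lemma continuity_2d_pt_fst (f : R -> R) (x y : R) :
  continuous f x -> continuity_2d_pt (fun u _ => f u) x y.
Proof.
  intros Hf; apply (continuity_1d_2d_pt_comp f (fun u _ => u)).
  - now apply continuity_pt_filterlim.
  - apply continuity_2d_pt_id1.
Qed.

Lemma continuity_2d_pt_snd (f : R -> R) (x y : R) :
  continuous f y -> continuity_2d_pt (fun _ v => f v) x y.
Proof.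
  intros Hf; apply (continuity_1d_2d_pt_comp f (fun _ v => v)).
  - now apply continuity_pt_filterlim.
  - apply continuity_2d_pt_id2.
Qed.

Lemma continuity_2d_pt_section (f : R -> R -> R) (x y : R) :
  continuity_2d_pt f x y -> continuous (fun u => f u y) x.
Proof.
  intros Hf.
  apply (continuous_comp_2 (fun u : R => u) (fun _ : R => y) f x).
  - apply continuous_id.
  - apply continuous_const.
  - now apply continuity_2d_pt_filterlim.
Qed.

Lemma in_open_locally (a b : Rbar) (t : R) :
  in_open a b t -> locally t (in_open a b).
Proof.
  intros [Ha Hb]; apply (locally_interval _ t a b Ha Hb).
  intros y Hay Hyb; now split.
Qed.

Lemma in_open_between (a b : Rbar) (C D t : R) :
  in_open a b C -> in_open a b D -> C <= t <= D -> in_open a b t.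
Proof.
  intros [HC _] [_ HD] [Ht1 Ht2]; split.
  - now apply Rbar_lt_le_trans with (Finite C).
  - now apply Rbar_le_lt_trans with (Finite D).
Qed.

Lemma ex_RInt_section (K : R -> R -> R) (A B t : R) :
  A <= B -> (forall x, A <= x <= B -> continuity_2d_pt K x t) ->
  ex_RInt (fun x => K x t) A B.
Proof.
  intros AB HK; apply (ex_RInt_continuous (V := R_CompleteNormedModule)).
  rewrite Rmin_left, Rmax_right by assumption.
  intros z Hz; now apply continuity_2d_pt_section, HK.
Qed.

(** Uniform continuity of [K] near the compact segment [[A,B]] at time [t] bounds the difference of
    the two integrands by a small constant. *)
Lemma continuous_RInt_param (K : R -> R -> R) (A B t : R) :
  A <= B ->
  locally t (fun s => forall x, A <= x <= B -> continuity_2d_pt K x s) ->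
  continuous (fun s => RInt (fun x => K x s) A B) t.
Proof.
  intros AB HK; apply filterlim_locally; intros eps.
  (* The [+ 1] keeps the denominator positive when [A = B] and makes the final bound strict. *)
  assert (He : 0 < eps / (B - A + 1)).
  { apply Rdiv_lt_0_compat; [apply cond_pos | lra]. }
  destruct (uniform_continuity_2d_1d K A B t (locally_singleton _ _ HK)
              (mkposreal _ He)) as [d Hd]; simpl in Hd.
  generalize (filter_and _ _ HK (locally_ball t d)); apply filter_imp.
  intros s [Ks Hs].
  assert (Kt := locally_singleton _ _ HK).
  assert (Hs' : Rabs (s - t) < d) by exact Hs.
  apply Rabs_lt_between in Hs'.
  change (Rabs (RInt (fun x => K x s) A B - RInt (fun x => K x t) A B) < eps).
  rewrite <- (RInt_minus (V := R_CompleteNormedModule))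
    by (now apply ex_RInt_section).
  apply Rle_lt_trans with ((B - A) * (eps / (B - A + 1))).
  - apply abs_RInt_le_const; [exact AB | | ].
    + apply (ex_RInt_minus (V := R_NormedModule)); now apply ex_RInt_section.
    + intros x Hx; apply Rlt_le, Hd; try assumption; try lra.
      rewrite Rminus_eq_0, Rabs_R0; apply cond_pos.
  - apply Rlt_le_trans with ((B - A + 1) * (eps / (B - A + 1))).
    + apply Rmult_lt_compat_r; [exact He | lra].
    + right; field; lra.
Qed.

Lemma is_RInt_box_continuous (a b : Rbar) (K : R -> R -> R) (A B C D : R) :
  A <= B -> C <= D -> in_open a b C -> in_open a b D ->
  (forall x t, in_open a b t -> continuity_2d_pt K x t) ->
  is_RInt_box K A B C D (RInt (fun t => RInt (fun x => K x t) A B) C D).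
Proof.
  intros AB CD HC HD HK.
  exists (fun t => RInt (fun x => K x t) A B); split.
  - intros t Ht; apply (RInt_correct (V := R_CompleteNormedModule)).
    apply ex_RInt_section; [exact AB |].
    intros x _; apply HK; now apply in_open_between with C D.
  - apply (RInt_correct (V := R_CompleteNormedModule)), (ex_RInt_continuous (V := R_CompleteNormedModule)).
    rewrite Rmin_left, Rmax_right by assumption.
    intros t Ht; apply continuous_RInt_param; [exact AB |].
    generalize (in_open_locally _ _ _ (in_open_between _ _ _ _ _ HC HD Ht)).
    apply filter_imp; intros s Hs x _; now apply HK.
Qed.

(** * Integrands with compact support and functions vanishing on one side *)

Lemma RInt_zero (k : R -> R) (A B : R) :
  A <= B -> (forall x, A < x < B -> k x = 0) -> RInt k A B = 0.
Proof.
  intros AB Hk; rewrite (RInt_ext k (fun _ => 0)).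
  - rewrite RInt_const; apply Rmult_0_r.
  - now rewrite Rmin_left, Rmax_right.
Qed.

(** After the translation the support is [[A - X, B - X]], and enlarging the interval beyond it adds
    nothing. Bounds [P], [Q] that serve for every time make the integral in the moving frame fit for
    differentiation under the integral sign. *)
Lemma RInt_translate_support (k : R -> R) (A B P Q X : R) :
  A <= B -> (forall x, continuous k x) ->
  (forall x, ~ (A <= x <= B) -> k x = 0) ->
  P <= A - X -> B - X <= Q ->
  RInt k A B = RInt (fun xi => k (xi + X)) P Q.
Proof.
  intros AB Ck Hk HP HQ.
  assert (Ek : forall u v, ex_RInt k u v).
  { intros u v; apply (ex_RInt_continuous (V := R_CompleteNormedModule)); intros; apply Ck. }
  (* The bounds have the shape that [RInt_comp_lin] expects for the affine map of slope [1]. *)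
  transitivity (RInt k (1 * P + X) (1 * Q + X)).
  - rewrite <- (RInt_Chasles k (1 * P + X) A) by apply Ek.
    rewrite <- (RInt_Chasles k A B (1 * Q + X)) by apply Ek.
    rewrite (RInt_zero k (1 * P + X) A), (RInt_zero k B (1 * Q + X));
      try lra; try (intros; apply Hk; lra).
    unfold plus; simpl; lra.
  - rewrite <- (RInt_comp_lin k 1 X P Q) by apply Ek.
    apply RInt_ext; intros x _.
    rewrite (Rmult_1_l x); apply Rmult_1_l.
Qed.

Lemma locally_not_in_interval (u v x : R) :
  ~ (u <= x <= v) -> locally x (fun y => ~ (u <= y <= v)).
Proof.
  intros Hx; destruct (Rlt_or_le x u) as [Hu | Hu].
  - apply (locally_interval _ x m_infty u); [easy | exact Hu |].
    intros y _ Hy; simpl in Hy; lra.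
  - apply (locally_interval _ x v p_infty); [simpl; lra | easy |].
    intros y Hy _; simpl in Hy; lra.
Qed.

(** The limit from the left is both [k c] and [0]. This gives the values of a test function on the
    edges of its box, where the support condition itself says nothing. *)
Lemma continuous_zero_left (k : R -> R) (c : R) :
  continuous k c -> (forall x, x < c -> k x = 0) -> k c = 0.
Proof.
  intros Hk H0.
  apply (filterlim_locally_unique (F := at_left c) k).
  - eapply filterlim_filter_le_1; [apply filter_le_within | exact Hk].
  - apply (filterlim_ext_loc (fun _ => 0)); [| apply filterlim_const].
    exists (mkposreal 1 Rlt_0_1); intros y _ Hy; symmetry; now apply H0.
Qed.

Lemma continuous_zero_right (k : R -> R) (c : R) :
  continuous k c -> (forall x, c < x -> k x = 0) -> k c = 0.
Proof.
  intros Hk H0.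
  apply (filterlim_locally_unique (F := at_right c) k).
  - eapply filterlim_filter_le_1; [apply filter_le_within | exact Hk].
  - apply (filterlim_ext_loc (fun _ => 0)); [| apply filterlim_const].
    exists (mkposreal 1 Rlt_0_1); intros y _ Hy; symmetry; now apply H0.
Qed.

(** * Differentiability and boundary values of test functions *)

Section TestFunction.

Context {a b : Rbar} {A B C D : R} {phi : R -> R -> R}.
Hypothesis Hphi : test_function a b A B C D phi.

Lemma test_is_derive_dx (x t : R) :
  is_derive (fun y => phi y t) x (dx phi x t).
Proof. unfold dx; apply Derive_correct; destruct Hphi as [_ [Hd _]]; exact (proj1 (Hd x t)). Qed.

(** Chain rule along the path followed by a point at rest in the moving frame. Total
    differentiability of [phi] comes from its partial derivatives and the continuity of [dx phi]. *)
Lemma test_is_derive_path (X : R -> R) (v xi t : R) :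
  is_derive X t v ->
  is_derive (fun s => phi (xi + X s) s) t
    (v * dx phi (xi + X t) t + dt phi (xi + X t) t).
Proof.
  destruct Hphi as [_ [Hd [Hc _]]]; intros HX.
  apply is_derive_Reals.
  replace (v * dx phi (xi + X t) t + dt phi (xi + X t) t)
    with (dx phi (xi + X t) t * v + dt phi (xi + X t) t * 1) by ring.
  apply (derivable_pt_lim_comp_2d phi (fun s => xi + X s) (fun s => s)).
  - apply filterdiff_differentiable_pt_lim.
    apply (is_derive_filterdiff phi _ _ (dx phi)).
    + apply filter_forall; intros u; apply test_is_derive_dx.
    + apply Derive_correct; exact (proj2 (Hd (xi + X t) t)).
    + apply continuity_2d_pt_filterlim, Hc.
  - apply is_derive_Reals; auto_derive; [now exists v |].
    replace (Derive _ t) with v by (symmetry; now apply is_derive_unique); ring.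
  - apply derivable_pt_lim_id.
Qed.

Lemma test_continuity (x t : R) : continuity_2d_pt phi x t.
Proof.
  destruct Hphi as [_ [Hd [Hc _]]].
  apply differentiable_continuity_pt.
  exists (dx phi x t), (dt phi x t).
  apply filterdiff_differentiable_pt_lim.
  apply (is_derive_filterdiff phi _ _ (dx phi)).
  - apply filter_forall; intros u; apply test_is_derive_dx.
  - apply Derive_correct; exact (proj2 (Hd x t)).
  - apply continuity_2d_pt_filterlim, Hc.
Qed.

(** The complement of [[A,B]] is open, so [phi] vanishes on a whole neighbourhood in [x]; in [t] the
    entire line through [x] avoids the box. *)
Lemma test_outside (x t : R) :
  ~ (A <= x <= B) -> phi x t = 0 /\ dx phi x t = 0 /\ dt phi x t = 0.
Proof.
  intros Hx; destruct Hphi as [_ [_ [_ Hs]]].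
  split; [| split].
  - apply Hs; tauto.
  - unfold dx; rewrite (Derive_ext_loc _ (fun _ => 0)); [apply Derive_const |].
    generalize (locally_not_in_interval _ _ _ Hx); apply filter_imp.
    intros y Hy; apply Hs; tauto.
  - unfold dt; rewrite (Derive_ext _ (fun _ => 0)); [apply Derive_const |].
    intros s; apply Hs; tauto.
Qed.

(** Removes the boundary terms when [E] is integrated by parts in [x]. *)
Lemma test_boundary_x (t : R) : phi A t = 0 /\ phi B t = 0.
Proof.
  destruct Hphi as [_ [Hd [_ Hs]]].
  assert (Hc : forall x, continuous (fun y => phi y t) x).
  { intros x; apply (ex_derive_continuous (V := R_NormedModule)).
    exact (proj1 (Hd x t)). }
  split.
  - apply (continuous_zero_left _ _ (Hc A)); intros x Hx; apply Hs; lra.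
  - apply (continuous_zero_right _ _ (Hc B)); intros x Hx; apply Hs; lra.
Qed.

(** Makes the integral over the moving frame vanish at the initial and final times of the box. *)
Lemma test_boundary_t (x : R) : phi x C = 0 /\ phi x D = 0.
Proof.
  destruct Hphi as [_ [Hd [_ Hs]]].
  assert (Hc : forall t, continuous (fun s => phi x s) t).
  { intros t; apply (ex_derive_continuous (V := R_NormedModule)).
    exact (proj2 (Hd x t)). }
  split.
  - apply (continuous_zero_left _ _ (Hc C)); intros t Ht; apply Hs; lra.
  - apply (continuous_zero_right _ _ (Hc D)); intros t Ht; apply Hs; lra.
Qed.

End TestFunction.

(** * Replacing the terms of a weak formulation by equal ones *)

Lemma is_RInt_box_ext (K L : R -> R -> R) (A B C D I : R) :
  (forall x t, C <= t <= D -> K x t = L x t) ->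
  is_RInt_box K A B C D I -> is_RInt_box L A B C D I.
Proof.
  intros KL [G [HG HI]]; exists G; split; [| exact HI].
  intros t Ht; apply (is_RInt_ext (fun x => K x t)); auto.
Qed.

(** Equality at the times of [(a,b)] suffices, since the box of a test function lies in that
    strip. *)
Lemma weak_solution_ext (a b : Rbar) (U F S U' F' S' : R -> R -> R) :
  (forall x t, in_open a b t ->
     U x t = U' x t /\ F x t = F' x t /\ S x t = S' x t) ->
  weak_solution a b U F S -> weak_solution a b U' F' S'.
Proof.
  intros E W A B C D phi Hphi.
  destruct (W A B C D phi Hphi) as (I1 & I2 & I3 & H1 & H2 & H3 & HI).
  exists I1, I2, I3.
  destruct Hphi as [(_ & _ & HC & HD) _].
  assert (E' : forall x t, C <= t <= D ->
    U x t = U' x t /\ F x t = F' x t /\ S x t = S' x t).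
  { intros x t Ht; apply E; now apply in_open_between with C D. }
  repeat split; [| | | exact HI].
  - revert H1; apply is_RInt_box_ext; intros x t Ht.
    now destruct (E' x t Ht) as [-> _].
  - revert H2; apply is_RInt_box_ext; intros x t Ht.
    now destruct (E' x t Ht) as [_ [-> _]].
  - revert H3; apply is_RInt_box_ext; intros x t Ht.
    now destruct (E' x t Ht) as [_ [_ ->]].
Qed.

(** * The weak balance law for a quantity carried by a moving frame *)

Section MovingFrame.

Context {a b : Rbar} {X v : R -> R} {q qt E Ex : R -> R -> R}.
Hypothesis HX : forall t, in_open a b t -> is_derive X t (v t).
Hypothesis Hv : forall t, in_open a b t -> continuous v t.
Hypothesis Hq : forall xi t, in_open a b t -> continuity_2d_pt q xi t.
Hypothesis Hqt : forall xi t, in_open a b t ->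
  is_derive (fun s => q xi s) t (qt xi t) /\ continuity_2d_pt qt xi t.
Hypothesis HE : forall x t, in_open a b t ->
  is_derive (fun y => E y t) x (Ex x t) /\
  continuity_2d_pt E x t /\ continuity_2d_pt Ex x t.

Let U x t := q (x - X t) t.
Let F x t := U x t * v t + E x t.
Let S x t := qt (x - X t) t + Ex x t.

Lemma continuous_frame (t : R) : in_open a b t -> continuous X t.
Proof.
  intros Ht; apply (ex_derive_continuous (V := R_NormedModule)).
  exists (v t); now apply HX.
Qed.

Lemma continuity_frame_shift (k : R -> R -> R) (x t : R) :
  in_open a b t -> (forall xi, continuity_2d_pt k xi t) ->
  continuity_2d_pt (fun y s => k (y - X s) s) x t.
Proof.
  intros Ht Hk; apply continuity_2d_pt_comp; [apply Hk | |].
  - apply continuity_2d_pt_minus; [apply continuity_2d_pt_id1 |].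
    now apply continuity_2d_pt_snd, continuous_frame.
  - apply continuity_2d_pt_id2.
Qed.

Lemma continuity_frame_unshift (k : R -> R -> R) (x t : R) :
  in_open a b t -> (forall xi, continuity_2d_pt k xi t) ->
  continuity_2d_pt (fun y s => k (y + X s) s) x t.
Proof.
  intros Ht Hk; apply continuity_2d_pt_comp; [apply Hk | |].
  - apply continuity_2d_pt_plus; [apply continuity_2d_pt_id1 |].
    now apply continuity_2d_pt_snd, continuous_frame.
  - apply continuity_2d_pt_id2.
Qed.

Lemma weak_solution_moving_frame : weak_solution a b U F S.
Proof.
  intros A B C D phi Hphi.
  destruct (Hphi) as [(AB & CD & HC & HD) [_ [Hcont _]]].
  assert (Hin : forall t, C <= t <= D -> in_open a b t).
  { intros t Ht; now apply in_open_between with C D. }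
  assert (CU : forall x t, in_open a b t -> continuity_2d_pt U x t).
  { intros x t Ht; apply continuity_frame_shift; auto. }
  assert (K1 : forall x t, in_open a b t ->
    continuity_2d_pt (fun x t => U x t * dt phi x t) x t).
  { intros x t Ht; apply continuity_2d_pt_mult; [now apply CU | apply Hcont]. }
  assert (K2 : forall x t, in_open a b t ->
    continuity_2d_pt (fun x t => F x t * dx phi x t) x t).
  { intros x t Ht; apply continuity_2d_pt_mult; [| apply Hcont].
    apply continuity_2d_pt_plus; [| now apply HE].
    apply continuity_2d_pt_mult; [now apply CU |].
    now apply continuity_2d_pt_snd, Hv. }
  assert (K3 : forall x t, in_open a b t ->
    continuity_2d_pt (fun x t => S x t * phi x t) x t).
  { intros x t Ht; apply continuity_2d_pt_mult.
    - apply continuity_2d_pt_plus; [| now apply HE].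
      apply continuity_frame_shift; [exact Ht |].
      intros xi; now apply Hqt.
    - apply (test_continuity Hphi). }
  do 3 eexists.
  split; [apply (is_RInt_box_continuous a b); eauto; lra |].
  split; [apply (is_RInt_box_continuous a b); eauto; lra |].
  split; [apply (is_RInt_box_continuous a b); eauto; lra |].
  assert (CK : forall K : R -> R -> R,
    (forall x t, in_open a b t -> continuity_2d_pt K x t) ->
    ex_RInt (fun t => RInt (fun x => K x t) A B) C D).
  { intros K HK.
    destruct (is_RInt_box_continuous a b K A B C D) as [G [HG HI]]; auto; try lra.
    eexists; apply (is_RInt_ext G); [| exact HI].
    rewrite Rmin_left, Rmax_right by lra.
    intros t Ht; symmetry; apply is_RInt_unique, HG; lra. }
  rewrite <- (RInt_plus (V := R_CompleteNormedModule)) by auto.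
  rewrite <- (RInt_plus (V := R_CompleteNormedModule));
    [| apply (ex_RInt_plus (V := R_NormedModule)); auto | auto].
  (* With the displacement bounded by [M] on [[C,D]], the interval [[A - M, B + M]] contains the
     support of [phi] in the frame at all these times. *)
  assert (HM : exists M, forall t, C <= t <= D -> Rabs (X t) <= M).
  { destruct (bounded_continuity X C D) as [M HM].
    - intros t Ht; now apply continuous_frame, Hin.
    - exists M; intros t Ht; apply Rlt_le, (HM t Ht). }
  destruct HM as [M HM].
  assert (M0 : 0 <= M).
  { apply Rle_trans with (Rabs (X C)); [apply Rabs_pos | apply HM; lra]. }
  (* [psi] is the conserved quantity times the test function, both read in the frame, and [dpsi] is
     its time derivative at fixed [xi]. *)
  pose (psi := fun xi t => q xi t * phi (xi + X t) t).
  pose (dpsi := fun xi t => qt xi t * phi (xi + X t) t +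
    q xi t * (v t * dx phi (xi + X t) t + dt phi (xi + X t) t)).
  assert (Dpsi : forall xi t, in_open a b t ->
    is_derive (fun s => psi xi s) t (dpsi xi t)).
  { intros xi t Ht; apply (is_derive_mult (fun s => q xi s) (fun s => phi (xi + X s) s)).
    - now apply Hqt.
    - now apply (test_is_derive_path Hphi), HX.
    - intros; apply Rmult_comm. }
  assert (Cpsi : forall xi t, in_open a b t -> continuity_2d_pt psi xi t).
  { intros xi t Ht; apply continuity_2d_pt_mult; [now apply Hq |].
    apply continuity_frame_unshift; [exact Ht |].
    intros; apply (test_continuity Hphi). }
  assert (Cdpsi : forall xi t, in_open a b t -> continuity_2d_pt dpsi xi t).
  { intros xi t Ht; apply continuity_2d_pt_plus; apply continuity_2d_pt_mult.
    - now apply Hqt.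
    - apply continuity_frame_unshift; [exact Ht |].
      intros; apply (test_continuity Hphi).
    - now apply Hq.
    - apply continuity_2d_pt_plus; [apply continuity_2d_pt_mult |].
      + now apply continuity_2d_pt_snd, Hv.
      + apply (continuity_frame_unshift (dx phi)); [exact Ht |].
        intros; apply Hcont.
      + apply (continuity_frame_unshift (dt phi)); [exact Ht |].
        intros; apply Hcont. }
  pose (m := fun t => RInt (fun xi => psi xi t) (A - M) (B + M)).
  pose (dm := fun t => RInt (fun xi => dpsi xi t) (A - M) (B + M)).
  assert (Dm : forall t, in_open a b t -> is_derive m t (dm t)).
  { intros t Ht.
    assert (Eq : dm t = RInt (fun xi => Derive (fun s => psi xi s) t) (A - M) (B + M)).
    { apply RInt_ext; intros xi _; symmetry; now apply is_derive_unique, Dpsi. }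
    rewrite Eq.
    assert (Hloc := in_open_locally _ _ _ Ht).
    (* Differentiation under the integral sign. The parameter comes first here, hence the swapped
       arguments of [psi] and [dpsi]. *)
    apply (is_derive_RInt_param (fun s xi => psi xi s)).
    - revert Hloc; apply filter_imp; intros s Hs xi _.
      now exists (dpsi xi s); apply Dpsi.
    - intros xi _.
      apply continuity_2d_pt_ext_loc with (fun s y => dpsi y s).
      + destruct Hloc as [d Hd]; exists d; intros s y Hs _.
        symmetry; apply is_derive_unique, Dpsi; now apply Hd.
      + apply (continuity_2d_pt_comp dpsi (fun _ y => y) (fun s _ => s)).
        * now apply Cdpsi.
        * apply continuity_2d_pt_id2.
        * apply continuity_2d_pt_id1.
    - revert Hloc; apply filter_imp; intros s Hs.
      apply ex_RInt_section; [lra | auto]. }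
  (* At fixed time the three integrands add up to [dpsi], taken back to the variable [x], plus the
     [x]-derivative of [E * phi]. *)
  assert (Inner : forall t, C <= t <= D ->
    RInt (fun x => U x t * dt phi x t) A B + RInt (fun x => F x t * dx phi x t) A B
    + RInt (fun x => S x t * phi x t) A B = dm t).
  { intros t Ht; assert (Ht' := Hin t Ht).
    pose (k := fun x => dpsi (x - X t) t).
    assert (Ck : forall x, continuous k x).
    { intros x; apply (continuity_2d_pt_section (fun y s => dpsi (y - X s) s)).
      apply continuity_frame_shift; auto. }
    assert (Xt := HM t Ht); apply Rabs_le_between in Xt.
    transitivity (RInt (fun xi => k (xi + X t)) (A - M) (B + M)).
    2: { apply RInt_ext; intros xi _; unfold k; f_equal; ring. }
    rewrite <- (RInt_translate_support k A B (A - M) (B + M) (X t)); try lra.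
    2: exact Ck.
    2: { intros x Hx; destruct (test_outside Hphi x t Hx) as [p0 [px pt]].
         unfold k, dpsi; replace (x - X t + X t) with x by ring.
         rewrite p0, px, pt; ring. }
    (* [r] is the derivative of [E * phi] in [x]; its integral is zero because [phi] vanishes at [A]
       and [B]. *)
    pose (r := fun x => E x t * dx phi x t + Ex x t * phi x t).
    assert (Cr : forall x, continuous r x).
    { intros x; apply (continuity_2d_pt_section
        (fun x t => E x t * dx phi x t + Ex x t * phi x t)).
      apply continuity_2d_pt_plus; apply continuity_2d_pt_mult.
      - now apply HE.
      - apply Hcont.
      - now apply HE.
      - apply (test_continuity Hphi). }
    assert (Ir : is_RInt r A B 0).
    { replace 0 with (minus (E B t * phi B t) (E A t * phi A t)).
      2: { destruct (test_boundary_x Hphi t) as [-> ->].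
           unfold minus, plus, opp; simpl; ring. }
      apply (is_RInt_derive (V := R_CompleteNormedModule) (fun x => E x t * phi x t)); [| now intros].
      intros x _.
      replace (r x) with (plus (mult (Ex x t) (phi x t)) (mult (E x t) (dx phi x t)))
        by (unfold r, plus, mult; simpl; ring).
      apply (is_derive_mult (fun x => E x t) (fun x => phi x t)).
      - now apply HE.
      - apply (test_is_derive_dx Hphi).
      - intros; apply Rmult_comm. }
    (* The zero integral of [r] is added so that the two sides agree integrand by integrand. *)
    rewrite <- (Rplus_0_r (RInt k A B)), <- (is_RInt_unique _ _ _ _ Ir).
    assert (Ek : ex_RInt k A B).
    { apply (ex_RInt_continuous (V := R_CompleteNormedModule)); auto. }
    assert (Er : ex_RInt r A B) by now exists 0.
    assert (E1 : ex_RInt (fun x => U x t * dt phi x t) A B).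
    { apply (ex_RInt_section (fun x t => U x t * dt phi x t)); [lra | auto]. }
    assert (E2 : ex_RInt (fun x => F x t * dx phi x t) A B).
    { apply (ex_RInt_section (fun x t => F x t * dx phi x t)); [lra | auto]. }
    assert (E3 : ex_RInt (fun x => S x t * phi x t) A B).
    { apply (ex_RInt_section (fun x t => S x t * phi x t)); [lra | auto]. }
    rewrite <- (RInt_plus (V := R_CompleteNormedModule) k r) by auto.
    rewrite <- !(RInt_plus (V := R_CompleteNormedModule)); auto.
    2: now apply (ex_RInt_plus (V := R_NormedModule)).
    apply RInt_ext; intros x _.
    unfold plus, k, dpsi, r, S, F, U; simpl.
    replace (x - X t + X t) with x by ring; ring. }
  transitivity (RInt dm C D).
  { apply RInt_ext; rewrite Rmin_left, Rmax_right by lra.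
    intros t Ht; apply Inner; lra. }
  apply is_RInt_unique.
  (* [m] vanishes at both ends since [phi] does, so the integral of its derivative [dm] is zero. *)
  replace 0 with (minus (m D) (m C)).
  2: { unfold m; rewrite !RInt_zero; try lra.
       - unfold minus, plus, opp; simpl; ring.
       - intros xi _; unfold psi.
         destruct (test_boundary_t Hphi (xi + X C)) as [-> _]; ring.
       - intros xi _; unfold psi.
         destruct (test_boundary_t Hphi (xi + X D)) as [_ ->]; ring. }
  apply (is_RInt_derive (V := R_CompleteNormedModule) m dm);
    rewrite Rmin_left, Rmax_right by lra; intros t Ht.
  - now apply Dm, Hin.
  - apply continuous_RInt_param; [lra |].
    generalize (in_open_locally _ _ _ (Hin t Ht)).
    apply filter_imp; intros s Hs xi _; auto.
Qed.

End MovingFrame.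

(** * Pointwise solutions and rewriting of the balance laws *)

(** [is_derive_ext] with the premise an equality in [R], as [ring] expects. *)
Lemma is_derive_ext_R (f g : R -> R) (x l : R) :
  (forall y, f y = g y) -> is_derive f x l -> is_derive g x l.
Proof. apply (is_derive_ext (V := R_NormedModule)). Qed.

Lemma classical_at_intro (U F S : R -> R -> R) (x t Ut Fx : R) :
  is_derive (fun s => U x s) t Ut -> is_derive (fun y => F y t) x Fx ->
  Ut + Fx = S x t -> classical_at U F S x t.
Proof.
  intros HU HF E; split; [now exists Ut | split; [now exists Fx |]].
  unfold dt, dx; rewrite <- E; f_equal; now apply is_derive_unique.
Qed.

(** Lets each law be proved for simplified expressions, free of the wet indicator and of the depth
    average. *)
Lemma solves_ext {a b : Rbar} {H U F S U' F' S' : R -> R -> R} :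
  solves a b H U F S ->
  (forall x t, U x t = U' x t) -> (forall x t, F x t = F' x t) ->
  (forall x t, S x t = S' x t) ->
  solves a b H U' F' S'.
Proof.
  intros [Hcl Hw] EU EF ES; split.
  - intros x t Ht Hoff; destruct (Hcl x t Ht Hoff) as [[Ut HU] [[Fx HF] E]].
    apply classical_at_intro with Ut Fx.
    + now apply (is_derive_ext_R (fun s => U x s)).
    + now apply (is_derive_ext_R (fun y => F y t)).
    + rewrite <- ES, <- E; unfold dt, dx.
      f_equal; symmetry; now apply is_derive_unique.
  - now apply (weak_solution_ext a b U F S).
Qed.

(** * The parabolic profile and the smoothness of its square *)

(** Squaring removes the kink of the positive part: both one-sided slopes at [0] are zero. *)
Lemma is_derive_sqr_pos_part (y : R) :
  is_derive (fun z => Rmax z 0 ^ 2) y (2 * Rmax y 0).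
Proof.
  destruct (Rtotal_order y 0) as [Hy | [-> | Hy]].
  - rewrite Rmax_right by lra.
    apply is_derive_ext_loc with (fun _ => 0).
    + apply (locally_interval _ y m_infty 0); [easy | exact Hy |].
      intros z _ Hz; simpl in Hz; rewrite Rmax_right by lra; symmetry; apply Rmult_0_l.
    + rewrite Rmult_0_r; apply (is_derive_const (V := R_NormedModule)).
  - rewrite Rmax_right by lra; apply is_derive_Reals.
    (* At the origin the difference quotient is [h] for positive [h] and [0] otherwise, so [eps]
       itself serves as radius. *)
    intros eps Heps; exists (mkposreal eps Heps); intros h Hh Hlt; simpl in Hlt.
    rewrite Rplus_0_l, (Rmax_right 0 0) by lra.
    destruct (Rle_or_lt h 0).
    + rewrite Rmax_right by assumption.
      replace ((0 ^ 2 - 0 ^ 2) / h - 2 * 0) with 0 by (field; exact Hh).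
      now rewrite Rabs_R0.
    + rewrite Rmax_left by lra.
      now replace ((h ^ 2 - 0 ^ 2) / h - 2 * 0) with h by (field; exact Hh).
  - rewrite Rmax_left by lra.
    apply is_derive_ext_loc with (fun z => z ^ 2).
    + apply (locally_interval _ y 0 p_infty); [exact Hy | easy |].
      intros z Hz _; simpl in Hz; now rewrite Rmax_left by lra.
    + auto_derive; [easy | ring].
Qed.

Lemma continuous_pos_part (y : R) : continuous (fun z => Rmax z 0) y.
Proof.
  assert (E : forall z, (z + Rabs z) * / 2 = Rmax z 0).
  { intros z; destruct (Rle_or_lt z 0).
    - rewrite Rmax_right, Rabs_left1 by assumption; field.
    - rewrite Rmax_left, Rabs_pos_eq by lra; field. }
  apply (continuous_ext _ _ _ E), (continuous_scal_l (V := R_NormedModule)).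
  apply (continuous_plus (V := R_NormedModule)).
  - apply continuous_id.
  - apply continuous_Rabs.
Qed.

(** The cap as seen in the moving frame: [sol_H] at [(x,t)] is convertible with [profile] at
    [x - RInt f ti t], which later [change] steps rely on. *)
Definition profile (H0 b2 xi : R) : R := Rmax (H0 - b2 / 2 * xi ^ 2) 0.

Lemma continuous_profile (H0 b2 xi : R) : continuous (profile H0 b2) xi.
Proof.
  apply (continuous_comp (fun y => H0 - b2 / 2 * y ^ 2) (fun z => Rmax z 0)).
  - apply (ex_derive_continuous (V := R_NormedModule)); auto_derive; easy.
  - apply continuous_pos_part.
Qed.

Lemma is_derive_sqr_profile (H0 b2 X x : R) :
  is_derive (fun y => profile H0 b2 (y - X) ^ 2) x
    (- 2 * b2 * (x - X) * profile H0 b2 (x - X)).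
Proof.
  replace (- 2 * b2 * (x - X) * profile H0 b2 (x - X))
    with (scal (- b2 * (x - X)) (2 * Rmax (H0 - b2 / 2 * (x - X) ^ 2) 0)).
  - apply (is_derive_comp (fun z => Rmax z 0 ^ 2)
             (fun y => H0 - b2 / 2 * (y - X) ^ 2)).
    + apply is_derive_sqr_pos_part.
    + auto_derive; [easy | simpl; field].
  - unfold scal, profile; simpl; unfold mult; simpl; ring.
Qed.

(** * The wet indicator and the depth-averaged pressure *)

Lemma sol_H_nonneg (H0 b2 ti : R) (f : R -> R) (x t : R) :
  0 <= sol_H H0 b2 ti f x t.
Proof. apply Rmax_r. Qed.

Lemma mult_wet (H : R -> R -> R) (x t : R) :
  0 <= H x t -> H x t * wet H x t = H x t.
Proof.
  intros HH; unfold wet; destruct (Rlt_dec 0 (H x t)); [ring |].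
  replace (H x t) with 0 by lra; ring.
Qed.

(** The pressure is affine in [z] and zero at the surface, so its integral is half the bottom value
    times [H]. In a dry point the integral is zero, which settles the division by [H]. *)
Lemma depth_average_sol_p (g b2 : R) (H : R -> R -> R) (zb f : R -> R) (x t : R) :
  0 <= H x t ->
  depth_average H zb (sol_p g b2 H zb f) x t = (g + b2 * f t ^ 2) / 2 * H x t.
Proof.
  intros HH; unfold depth_average.
  set (c := g + b2 * f t ^ 2).
  assert (I : RInt (fun z => sol_p g b2 H zb f x z t) (zb x) (H x t + zb x)
              = c * wet H x t * (H x t ^ 2 / 2)).
  { apply is_RInt_unique.
    pose (P := fun z => - (c * wet H x t) * ((H x t + zb x - z) ^ 2 / 2)).
    replace (c * wet H x t * (H x t ^ 2 / 2))
      with (minus (P (H x t + zb x)) (P (zb x)))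
      by (unfold P, minus, plus, opp; simpl; field).
    apply (is_RInt_derive (V := R_CompleteNormedModule) P); intros z _.
    - unfold P, sol_p; fold c; auto_derive; [easy | simpl; field].
    - apply (ex_derive_continuous (V := R_NormedModule)).
      unfold sol_p; auto_derive; easy. }
  rewrite I; destruct HH as [HH | HH].
  - unfold wet; destruct (Rlt_dec 0 (H x t)); [field; lra | lra].
  - rewrite <- HH; unfold Rdiv; ring.
Qed.

(** * The four balance laws for the moving cap *)

Section Solution.

Context {g H0 b1 b2 ti : R} {a b : Rbar} {f : R -> R}.
Hypothesis Hti : in_open a b ti.
Hypothesis Hf : forall t, in_open a b t ->
  ex_derive f t /\
  Derive f t + b2 * (g + b2 * f t ^ 2) * RInt f ti t = 0.

Let X t := RInt f ti t.
Let H := sol_H H0 b2 ti f.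
Let zb := sol_zb b1 b2.

Lemma velocity_continuous (t : R) : in_open a b t -> continuous f t.
Proof.
  intros Ht; apply (ex_derive_continuous (V := R_NormedModule)); now apply Hf.
Qed.

Lemma velocity_is_derive (t : R) : in_open a b t -> is_derive f t (Derive f t).
Proof. intros Ht; now apply Derive_correct, Hf. Qed.

(** Fundamental theorem of calculus: the segment from [ti] to any time near [t] stays in [(a,b)],
    where [f] is continuous. *)
Lemma center_is_derive (t : R) : in_open a b t -> is_derive X t (f t).
Proof.
  intros Ht; apply (is_derive_RInt f X ti); [| now apply velocity_continuous].
  generalize (in_open_locally _ _ _ Ht); apply filter_imp; intros s Hs.
  apply (RInt_correct (V := R_CompleteNormedModule)).
  apply (ex_RInt_continuous (V := R_CompleteNormedModule)); intros r Hr.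
  apply velocity_continuous.
  apply (in_open_between a b (Rmin ti s) (Rmax ti s)); [| | exact Hr].
  - now apply Rmin_case.
  - now apply Rmax_case.
Qed.

Lemma center_continuous (t : R) : in_open a b t -> continuous X t.
Proof.
  intros Ht; apply (ex_derive_continuous (V := R_NormedModule)).
  exists (f t); now apply center_is_derive.
Qed.

(** The differential equation expresses [Derive f] through [f] and [X], so [f] is in fact C^1. *)
Lemma acceleration_continuous (t : R) :
  in_open a b t -> continuous (Derive f) t.
Proof.
  intros Ht.
  apply (continuous_ext_loc _ (fun s => - (b2 * (g + b2 * f s ^ 2)) * X s)).
  - generalize (in_open_locally _ _ _ Ht); apply filter_imp; intros s Hs.
    destruct (Hf s Hs) as [_ E]; unfold X; lra.
  - apply (ex_derive_continuous (V := R_NormedModule)).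
    auto_derive; repeat split; [now apply Hf |].
    exists (f t); now apply center_is_derive.
Qed.

(** Rigid transport ties the time slope of [H] to its space slope [k]. The last identity covers both
    cases at once: [k] is the slope of the parabola in wet points, and [H] is zero in dry ones. *)
Lemma off_front_is_derive (x t : R) :
  in_open a b t -> off_front H x t ->
  exists k, is_derive (fun y => H y t) x k /\
    is_derive (fun s => H x s) t (- f t * k) /\
    H x t * (k + b2 * (x - X t)) = 0.
Proof.
  intros Ht [Hwet | Hdry].
  - assert (E : forall y s, 0 < H y s -> H0 - b2 / 2 * (y - X s) ^ 2 = H y s).
    { intros y s; unfold H, sol_H; fold (X s).
      unfold Rmax; destruct (Rle_dec _ 0); lra. }
    exists (- b2 * (x - X t)); split; [| split].
    + apply is_derive_ext_loc with (fun y => H0 - b2 / 2 * (y - X t) ^ 2).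
      * generalize (locally_2d_1d_const_y _ _ _ Hwet); apply filter_imp.
        intros y; apply E.
      * auto_derive; [easy | simpl; field].
    + apply is_derive_ext_loc with (fun s => H0 - b2 / 2 * (x - X s) ^ 2).
      * generalize (locally_2d_1d_const_x _ _ _ Hwet); apply filter_imp.
        intros s; apply E.
      * assert (DX := center_is_derive t Ht).
        auto_derive; [now exists (f t) |].
        replace (Derive _ t) with (f t) by (symmetry; now apply is_derive_unique).
        simpl; field.
    + ring.
  - exists 0; split; [| split].
    + apply is_derive_ext_loc with (fun _ => 0).
      * generalize (locally_2d_1d_const_y _ _ _ Hdry); apply filter_imp.
        intros y; apply eq_sym.
      * apply (is_derive_const (V := R_NormedModule)).
    + apply is_derive_ext_loc with (fun _ => 0).
      * generalize (locally_2d_1d_const_x _ _ _ Hdry); apply filter_imp.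
        intros y; apply eq_sym.
      * rewrite Rmult_0_r; apply (is_derive_const (V := R_NormedModule)).
    + rewrite (locally_2d_singleton _ _ _ Hdry); ring.
Qed.

(** [V] is the transported quantity per unit height, in the coordinates
    [xi = x - X t] of the moving frame. *)
Lemma weak_solution_profile (V Vt E Ex U F S : R -> R -> R) :
  (forall xi t, in_open a b t ->
     is_derive (fun s => V xi s) t (Vt xi t) /\
     continuity_2d_pt V xi t /\ continuity_2d_pt Vt xi t) ->
  (forall x t, in_open a b t ->
     is_derive (fun y => E y t) x (Ex x t) /\
     continuity_2d_pt E x t /\ continuity_2d_pt Ex x t) ->
  (forall x t, in_open a b t ->
     H x t * V (x - X t) t = U x t /\
     H x t * V (x - X t) t * f t + E x t = F x t /\
     H x t * Vt (x - X t) t + Ex x t = S x t) ->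
  weak_solution a b U F S.
Proof.
  intros HV HE Eq; eapply weak_solution_ext; [exact Eq |].
  apply (@weak_solution_moving_frame a b X f
    (fun xi t => profile H0 b2 xi * V xi t) (fun xi t => profile H0 b2 xi * Vt xi t)).
  - exact center_is_derive.
  - exact velocity_continuous.
  - intros xi t Ht; apply continuity_2d_pt_mult; [| now apply HV].
    apply continuity_2d_pt_fst, continuous_profile.
  - intros xi t Ht; split.
    + apply (is_derive_scal (fun s => V xi s)); now apply HV.
    + apply continuity_2d_pt_mult; [| now apply HV].
      apply continuity_2d_pt_fst, continuous_profile.
  - exact HE.
Qed.

Lemma continuity_height (x t : R) : in_open a b t -> continuity_2d_pt H x t.
Proof.
  intros Ht; apply (continuity_2d_pt_comp (fun xi _ => profile H0 b2 xi)
    (fun x t => x - X t) (fun _ t => t)).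
  - apply continuity_2d_pt_fst, continuous_profile.
  - apply continuity_2d_pt_minus; [apply continuity_2d_pt_id1 |].
    now apply continuity_2d_pt_snd, center_continuous.
  - apply continuity_2d_pt_id2.
Qed.

(** Powers and quotients are outside its patterns, hence the squares written as products and the
    unfolding of [Rdiv] before its calls. *)
Ltac continuity_2d :=
  lazymatch goal with
  | |- continuity_2d_pt (fun u v => _ + _) _ _ =>
      apply continuity_2d_pt_plus; continuity_2d
  | |- continuity_2d_pt (fun u v => _ - _) _ _ =>
      apply continuity_2d_pt_minus; continuity_2d
  | |- continuity_2d_pt (fun u v => _ * _) _ _ =>
      apply continuity_2d_pt_mult; continuity_2d
  | |- continuity_2d_pt (fun u v => - _) _ _ =>
      apply continuity_2d_pt_opp; continuity_2d
  | |- continuity_2d_pt H _ _ =>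
      apply continuity_height; assumption
  | |- continuity_2d_pt (fun u v => profile _ _ u) _ _ =>
      apply continuity_2d_pt_fst, continuous_profile
  | |- continuity_2d_pt (fun u v => f v) _ _ =>
      apply continuity_2d_pt_snd, velocity_continuous; assumption
  | |- continuity_2d_pt (fun u v => X v) _ _ =>
      apply continuity_2d_pt_snd, center_continuous; assumption
  | |- continuity_2d_pt (fun u v => Derive f v) _ _ =>
      apply continuity_2d_pt_snd, acceleration_continuous; assumption
  | |- continuity_2d_pt (fun u v => u) _ _ => apply continuity_2d_pt_id1
  | |- continuity_2d_pt (fun u v => v) _ _ => apply continuity_2d_pt_id2
  | |- continuity_2d_pt (fun u v => ?c) _ _ => apply continuity_2d_pt_const
  end.

Ltac constant_density :=
  intros x t Ht; split; [| split];
  [apply (is_derive_const (V := R_NormedModule)) | continuity_2d | continuity_2d].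

Ltac derive_with t Ht :=
  let DX := fresh in let Df := fresh in
  assert (DX := center_is_derive t Ht); assert (Df := velocity_is_derive t Ht);
  auto_derive; [repeat split; eexists; eassumption |];
  repeat match goal with D : is_derive ?k ?u ?l |- context [Derive ?k' ?u] =>
    progress replace (Derive k' u) with l by (symmetry; apply is_derive_unique; exact D) end.

Lemma solves_mass : solves a b H H (fun x t => H x t * f t) (fun _ _ => 0).
Proof.
  split.
  - intros x t Ht Hoff; destruct (off_front_is_derive x t Ht Hoff) as (k & Hx & Hs & _).
    apply classical_at_intro with (- f t * k) (f t * k); [exact Hs | | ring].
    apply (is_derive_ext_R (fun y => f t * H y t)); [intros; apply Rmult_comm |].
    now apply is_derive_scal.
  - apply (weak_solution_profile (fun _ _ => 1) (fun _ _ => 0) (fun _ _ => 0) (fun _ _ => 0)).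
    + constant_density.
    + constant_density.
    + intros x t _; repeat split; ring.
Qed.

(** The density per unit height is [f] and the pressure is [E]. The differential equation makes the
    inertia [H * Derive f] cancel the part of the pressure gradient due to the displacement [X t],
    leaving the bottom slope term. *)
Lemma solves_horizontal_momentum :
  solves a b H (fun x t => H x t * f t)
    (fun x t => H x t * f t * f t + (g + b2 * f t ^ 2) / 2 * H x t ^ 2)
    (fun x t => - ((g + b2 * f t ^ 2) * H x t) * (b2 * x)).
Proof.
  split.
  - intros x t Ht Hoff; destruct (off_front_is_derive x t Ht Hoff) as (k & Hx & Hs & Hk).
    destruct (Hf t Ht) as [_ Ef]; fold (X t) in Ef.
    eapply classical_at_intro.
    + apply (is_derive_mult (fun s => H x s) f); [exact Hs | now apply velocity_is_derive |].
      intros; apply Rmult_comm.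
    + apply (is_derive_plus (fun y => H y t * f t * f t)).
      * apply (is_derive_ext_R (fun y => (f t * f t) * H y t)); [intros; ring |].
        apply is_derive_scal, Hx.
      * apply is_derive_scal, is_derive_pow, Hx.
    + unfold plus, mult; simpl.
      replace (Derive f t) with (- (b2 * (g + b2 * f t ^ 2) * X t)) by lra.
      apply Rminus_diag_uniq.
      (* Once [Derive f] is eliminated, the residual is a multiple of the expression that vanishes
         off the front. *)
      transitivity ((g + b2 * f t ^ 2) * (H x t * (k + b2 * (x - X t)))).
      * simpl; field.
      * rewrite Hk; ring.
  - apply (weak_solution_profile (fun _ t => f t) (fun _ t => Derive f t)
      (fun x t => (g + b2 * (f t * f t)) / 2 * (H x t * H x t))
      (fun x t => - (g + b2 * (f t * f t)) * (b2 * (x - X t)) * H x t)).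
    + intros xi t Ht; split; [now apply velocity_is_derive | split; continuity_2d].
    + intros x t Ht; split; [| split; unfold Rdiv; continuity_2d].
      apply (is_derive_ext_R
        (fun y => (g + b2 * (f t * f t)) / 2 * profile H0 b2 (y - X t) ^ 2)).
      { intros y; unfold H, sol_H, profile, X; simpl; ring. }
      replace (- (g + b2 * (f t * f t)) * (b2 * (x - X t)) * H x t) with
        ((g + b2 * (f t * f t)) / 2 *
           (- 2 * b2 * (x - X t) * profile H0 b2 (x - X t)))
        by (change (profile H0 b2 (x - X t)) with (H x t); field).
      apply is_derive_scal, is_derive_sqr_profile.
    + intros x t Ht; split; [reflexivity | split; [field |]].
      destruct (Hf t Ht) as [_ Ef]; fold (X t) in Ef.
      replace (Derive f t) with (- (b2 * (g + b2 * f t ^ 2) * X t)) by lra.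
      simpl; ring.
Qed.

(** The density [b2 * x * f] reads [b2 * (xi + X t) * f t] in the frame; its time derivative yields
    [b2 * f ^ 2], the non-hydrostatic term, and [b2 * x * Derive f], the forcing. *)
Lemma solves_vertical_momentum :
  solves a b H (fun x t => H x t * (b2 * x * f t))
    (fun x t => H x t * (b2 * x * f t) * f t)
    (fun x t => b2 * f t ^ 2 * H x t + H x t * (b2 * x * Derive f t)).
Proof.
  split.
  - intros x t Ht Hoff; destruct (off_front_is_derive x t Ht Hoff) as (k & Hx & Hs & _).
    eapply classical_at_intro.
    + apply (is_derive_mult (fun s => H x s) (fun s => b2 * x * f s)); [exact Hs | |].
      * now apply is_derive_scal, velocity_is_derive.
      * intros; apply Rmult_comm.
    + apply (is_derive_ext_R (fun y => (b2 * f t ^ 2) * (H y t * y))); [intros; simpl; ring |].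
      apply is_derive_scal, (is_derive_mult (fun y => H y t) (fun y => y)); [exact Hx | |].
      * apply (is_derive_id (K := R_AbsRing)).
      * intros; apply Rmult_comm.
    + unfold plus, mult, one; simpl; ring.
  - apply (weak_solution_profile (fun xi t => b2 * (xi + X t) * f t)
      (fun xi t => b2 * (f t * f t) + b2 * (xi + X t) * Derive f t)
      (fun _ _ => 0) (fun _ _ => 0)).
    + intros xi t Ht; split; [| split; continuity_2d].
      derive_with t Ht; ring.
    + constant_density.
    + intros x t _; repeat split; simpl; ring.
Qed.

(** The conserved quantity factors as [H * (H / 2 + zb)]. In the frame [H] is steady, so only the
    bottom seen by the moving cap varies, at rate [b2 * x * f]. *)
Lemma solves_potential :
  solves a b H (fun x t => H x t * (H x t / 2 + zb x))
    (fun x t => H x t * (H x t / 2 + zb x) * f t)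
    (fun x t => H x t * (b2 * x * f t)).
Proof.
  split.
  - intros x t Ht Hoff; destruct (off_front_is_derive x t Ht Hoff) as (k & Hx & Hs & _).
    apply classical_at_intro with (- f t * k * (H x t + zb x))
      (f t * (k * (H x t + zb x)) + H x t * (b2 * x * f t)).
    + apply (is_derive_ext_R (fun s => / 2 * H x s ^ 2 + zb x * H x s)); [intros; simpl; field |].
      evar_last.
      * apply (is_derive_plus (fun s => / 2 * H x s ^ 2)).
        -- apply is_derive_scal, is_derive_pow, Hs.
        -- apply is_derive_scal, Hs.
      * unfold plus; simpl; field.
    + apply (is_derive_ext_R (fun y => f t * (/ 2 * H y t ^ 2 + zb y * H y t)));
        [intros; simpl; field |].
      evar_last.
      * apply is_derive_scal, (is_derive_plus (fun y => / 2 * H y t ^ 2)).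
        -- apply is_derive_scal, is_derive_pow, Hx.
        -- apply (is_derive_mult zb (fun y => H y t)); [| exact Hx | intros; apply Rmult_comm].
           apply (is_derive_ext_R (fun y => b1 + b2 / 2 * y ^ 2)); [easy |].
           auto_derive; [easy | reflexivity].
      * unfold plus, mult; simpl; field.
    + ring.
  - apply (weak_solution_profile
      (fun xi t => profile H0 b2 xi / 2 + (b1 + b2 / 2 * ((xi + X t) * (xi + X t))))
      (fun xi t => b2 * (xi + X t) * f t) (fun _ _ => 0) (fun _ _ => 0)).
    + intros xi t Ht; split; [| split; unfold Rdiv; continuity_2d].
      derive_with t Ht; field.
    + constant_density.
    + intros x t _.
      change (profile H0 b2 (x - X t)) with (H x t).
      repeat split; unfold zb, sol_zb; simpl; ring.
Qed.

End Solution.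

(** * Return to the depth-averaged unknowns with their wet indicator *)

Theorem proposition4 :
  forall (g H0 b1 b2 t0 ti f0 : R) (a b : Rbar) (f : R -> R),
    0 < H0 ->
    in_open a b t0 ->
    in_open a b ti ->
    (forall t, in_open a b t ->
       ex_derive f t /\
       Derive f t + b2 * (g + b2 * f t ^ 2) * RInt f ti t = 0) ->
    f t0 = f0 ->
    let H := sol_H H0 b2 ti f in
    let zb := sol_zb b1 b2 in
    let u := sol_u H f in
    let w := sol_w H b2 f in
    let s := sol_s b2 f in
    let pbar := depth_average H zb (sol_p g b2 H zb f) in
    depth_averaged_euler g a b H u w zb pbar s.
Proof.
  intros g H0 b1 b2 t0 ti f0 a b f _ _ Hti Hf _ H zb u w s pbar.
  assert (HH : forall x t, 0 <= H x t) by (intros; apply sol_H_nonneg).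
  assert (Hw : forall x t, H x t * wet H x t = H x t) by (intros; now apply mult_wet).
  assert (Eu : forall x t, H x t * u x t = H x t * f t).
  { intros x t; unfold u, sol_u; rewrite <- (Hw x t) at 2; ring. }
  assert (Ew : forall x t, H x t * w x t = H x t * (b2 * x * f t)).
  { intros x t; unfold w, sol_w; rewrite <- (Hw x t) at 2; ring. }
  (* Removing the hydrostatic part [g / 2 * H] leaves the non-hydrostatic pressure. *)
  assert (Ep : forall x t, pbar x t - g / 2 * H x t = b2 / 2 * f t ^ 2 * H x t).
  { intros x t; unfold pbar; rewrite depth_average_sol_p by apply HH; field. }
  assert (Dzb : forall x, is_derive zb x (b2 * x)).
  { intros x; apply (is_derive_ext_R (fun y => b1 + b2 / 2 * y ^ 2)); [easy |].
    auto_derive; [easy | simpl; field]. }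
  split; [intros x; now exists (b2 * x) |].
  split; [| split; [| split]].
  - refine (solves_ext (solves_mass Hti Hf) _ _ _);
      intros x t; [easy | now rewrite Eu | easy].
  - refine (solves_ext (solves_horizontal_momentum Hti Hf) _ _ _);
      intros x t; fold H; [now rewrite Eu | |].
    + rewrite Ep.
      (* The indicator occurs squared, so [Eu] is applied once for each factor [u], with [H] kept
         alongside. *)
      replace (H x t * u x t ^ 2) with (H x t * f t * f t); [field |].
      rewrite <- Eu; replace (H x t * u x t * f t) with (u x t * (H x t * f t)) by ring.
      rewrite <- Eu; ring.
    + rewrite Ep, (is_derive_unique _ _ _ (Dzb x)); field.
  - refine (solves_ext (solves_vertical_momentum Hti Hf) _ _ _);
      intros x t; fold H; [now rewrite Ew | |].
    + rewrite <- Ew.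
      replace (H x t * w x t * f t) with (w x t * (H x t * f t)) by ring.
      rewrite <- Eu; ring.
    + rewrite Ep; unfold s, sol_s; field.
  - refine (solves_ext (solves_potential (b1 := b1) Hti Hf) _ _ _);
      intros x t; fold H; fold zb; [field | | now rewrite Ew].
    (* A factor [H] is brought next to the velocity, where it absorbs the indicator. *)
    replace (H x t * (H x t / 2 + zb x) * f t)
      with ((H x t / 2 + zb x) * (H x t * f t)) by ring.
    rewrite <- Eu; field.
Qed.
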